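(* Let $\mathcal{Z}=\mathcal{X}\times\mathcal{Y}$, let $F$ be a class of prediction functions $f:\mathcal{X}\to\mathcal{Y}$ parametrized as $f_\theta$, $\theta\in\Theta=\mathbb{R}^m$, and let the loss be $\ell(\theta;(x,y))=L(f_\theta(x),y)$ for a function $L$, continuous in $\theta$, with $|\ell(\theta;z)|\le T_\ell$ for all $\theta\in\Theta$, $z\in\mathcal{Z}$. Let $P_0$ be a distribution on $\mathcal{Z}$ and $\hat P_n$ the empirical distribution of $n$ i.i.d. samples from $P_0$. Fix a weight vector $w\in[1,\infty)^{m+1}$ and the cost $c_w(z_1,z_2)=\|w\odot(z_1-z_2)\|_2^2$. Then there is a numerical constant $k\ge 0$ such that for every $\theta\in\Theta$, $\rho\ge 0$, $\lambda\ge 0$ and $\delta\in(0,1)$, with probability at least $1-\delta$ over the sample, $$\sup_{P:\,W_{c_w}(P,P_0)\le\rho}\mathbb{E}_P[\ell(\theta;Z)]\le \lambda\rho+\mathbb{E}_{\hat P_n}[s_\lambda(\theta;Z)]+\mathcal{R}_n(\widetilde{\ell}\circ F)+kT_\ell\sqrt{\frac{\ln(1/\delta)}{n}}.$$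
   Context: $W_{c}(P,Q)=\inf_{M\in\Pi(P,Q)}\mathbb{E}_{(z,z')\sim M}[c(z,z')]$ is the Wasserstein distance with cost $c$, $\Pi(P,Q)$ being the couplings of $P$ and $Q$; $\odot$ is the coordinatewise product. The robust surrogate is $s_\lambda(\theta;z)=\sup_{\xi\in\mathcal{Z}}\big(\ell(\theta;\xi)-\lambda c_w(\xi,z)\big)$. The class $\widetilde{\ell}\circ F=\{(x,y)\mapsto L(f(x),y)-L(0,y): f\in F\}$, and for a class $G$ of functions on $\mathcal{Z}$, $\mathcal{R}_n(G)=\mathbb{E}\big[\sup_{g\in G}\frac1n\sum_{i=1}^n\sigma_i g(Z_i)\big]$ with $Z_i$ i.i.d. from $P_0$ and $\sigma_i$ i.i.d. uniform signs in $\{-1,+1\}$ independent of the $Z_i$. *)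

(* Defs.v *)
From HB Require Import structures.
From mathcomp Require Import all_boot all_order all_algebra.
From mathcomp Require Import all_classical all_reals all_analysis.
Set Implicit Arguments. Unset Strict Implicit. Unset Printing Implicit Defensive.
Import Order.TTheory GRing.Theory Num.Theory.
Import numFieldNormedType.Exports.
Local Open Scope classical_set_scope.
Local Open Scope ring_scope.

Definition Zsp (R : realType) (m : nat) := (m.-tuple R * R)%type.

(* weighted squared cost c_w(z1,z2) = || w (.) (z1 - z2) ||_2^2,
   w indexed by 'I_(m+1): the first m coordinates weight x, the last one y *)
Definition cw (R : realType) (m : nat) (w : 'rV[R]_m.+1) (z1 z2 : Zsp R m) : R :=
  \sum_(j < m) (w 0 (widen_ord (leqnSn m) j) * (tnth z1.1 j - tnth z2.1 j)) ^+ 2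
  + (w 0 ord_max * (z1.2 - z2.2)) ^+ 2.

Definition is_coupling d (T : measurableType d) (R : realType)
  (P Q : probability T R) (M : probability (T * T)%type R) : Prop :=
  forall A : set T, measurable A ->
    M (fst @^-1` A) = P A /\ M (snd @^-1` A) = Q A.

Definition wasserstein d (T : measurableType d) (R : realType)
  (c : T -> T -> R) (P Q : probability T R) : \bar R :=
  ereal_inf [set (\int[M]_p (c p.1 p.2)%:E)%E
            | M in [set M : probability (T * T)%type R | is_coupling P Q M]].

Definition loss (R : realType) (m : nat) (f : 'rV[R]_m -> m.-tuple R -> R)
  (L : R -> R -> R) (theta : 'rV[R]_m) (z : Zsp R m) : R :=
  L (f theta z.1) z.2.

Definition surrogate (R : realType) (m : nat) (Zset : set (Zsp R m))
  (f : 'rV[R]_m -> m.-tuple R -> R) (L : R -> R -> R) (w : 'rV[R]_m.+1)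
  (lam : R) (theta : 'rV[R]_m) (z : Zsp R m) : \bar R :=
  ereal_sup [set (loss f L theta xi - lam * cw w xi z)%:E | xi in Zset].

Definition sgn (R : realType) (b : bool) : R := if b then 1 else -1.

(* On the probability space (Omega, P): Z_1..Z_n are i.i.d. with law P0,
   sigma_1..sigma_n are i.i.d. uniform signs (sigma_i = sgn (sg i)), and the
   whole family (Z_1..Z_n, sigma_1..sigma_n) is mutually independent.
   Stated as the product rule on the generating rectangles. *)
Definition iid_sample_signs d (Omega : measurableType d) (R : realType) (m n : nat)
  (P : probability Omega R) (P0 : probability (Zsp R m) R)
  (Zs : 'I_n -> Omega -> Zsp R m) (sg : 'I_n -> Omega -> bool) : Prop :=
  [/\ (forall i, measurable_fun setT (Zs i)),
      (forall i, measurable_fun setT (sg i)) &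
      forall (A : 'I_n -> set (Zsp R m)) (b : 'I_n -> bool),
        (forall i, measurable (A i)) ->
        P (\bigcap_(i in [set: 'I_n]) [set om | A i (Zs i om) /\ sg i om = b i])
        = (\prod_(i < n) (fine (P0 (A i)) / 2))%:E].

(* Rademacher complexity R_n(tilde l o F), F = {f_theta : theta in R^m},
   tilde l o F = {(x,y) |-> L (f x) y - L 0 y : f in F},
   computed with the i.i.d. sample and the independent signs on (Omega, P) *)
Definition rademacher d (Omega : measurableType d) (R : realType) (m n : nat)
  (P : probability Omega R)
  (Zs : 'I_n -> Omega -> Zsp R m) (sg : 'I_n -> Omega -> bool)
  (f : 'rV[R]_m -> m.-tuple R -> R) (L : R -> R -> R) : \bar R :=
  (\int[P]_om ereal_sup [set (n%:R^-1 * \sum_(i < n) sgn R (sg i om) *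
        (L (f theta (Zs i om).1) (Zs i om).2 - L 0 (Zs i om).2))%:E
      | theta in [set: 'rV[R]_m]])%E.

Definition dro_risk (R : realType) (m : nat) (Zset : set (Zsp R m))
  (f : 'rV[R]_m -> m.-tuple R -> R) (L : R -> R -> R) (w : 'rV[R]_m.+1)
  (P0 : probability (Zsp R m) R) (rho : R) (theta : 'rV[R]_m) : \bar R :=
  ereal_sup [set (\int[Q]_(z in Zset) (loss f L theta z)%:E)%E
            | Q in [set Q : probability (Zsp R m) R |
                    Q Zset = 1%E /\ (wasserstein (cw w) Q P0 <= rho%:E)%E]].

(* Main.v *)
(* Weak Kantorovich duality is pointwise: l(z) <= s_lam(z') + lam c_w(z,z'), so
   integrating against a coupling of Q and P0 gives
   E_Q l <= lam W_c(Q,P0) + E_{P0} s_lam.  On the support s_lam is bounded by Tl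
   in absolute value, so E_{P0} s_lam is compared with the empirical mean by a
   Hoeffding bound, after rounding s_lam down to finitely many values; the
   rounding error is absorbed by the slack k Tl sqrt(ln(1/delta)/n).  The
   Rademacher term only helps: it dominates E[(1/n) sum_i sigma_i g(Z_i)] = 0 for
   any single g of the class. *)
Require Import Defs.
From HB Require Import structures.
From mathcomp Require Import all_boot all_order all_algebra.
From mathcomp Require Import all_classical all_reals all_analysis.
From mathcomp Require Import measurable_realfun ring lra.
Import Order.TTheory GRing.Theory Num.Theory.
Import numFieldNormedType.Exports.
Local Open Scope classical_set_scope.
Local Open Scope ring_scope.
Set Implicit Arguments.
Unset Strict Implicit.
Unset Printing Implicit Defensive.

(** * A Hoeffding bound for finitely supported distributions *)

(** The linear term is kept apart so that it averages out against a centered variable, which leaves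
    a purely quadratic exponent. For [x >= 1/3] already [x <= 3 * x ^+ 2]; below that, squaring
    [1 - x / 2 <= expR (- (x / 2))] yields [expR x <= 1 + x + x ^+ 2]. *)
Lemma expR_le_add_expR_sqr (R : realType) (x : R) :
  expR x <= x + expR (3 * x ^+ 2).
Proof.
have [x3|x3] := lerP (3^-1) x.
  apply: (@le_trans _ _ (expR (3 * x ^+ 2))); last by rewrite lerDr; lra.
  by rewrite ler_expR; nra.
have h1 : 0 < 1 - x / 2 by lra.
have h2 : 1 - x / 2 <= expR (- (x / 2)).
  by apply: le_trans (expR_ge1Dx _); lra.
have h3 : expR x <= 1 + x + x ^+ 2.
  rewrite -[X in expR X]opprK expRN -[X in X <= _]mul1r ler_pdivrMr ?expR_gt0//.
  have -> : expR (- x) = expR (- (x / 2)) ^+ 2 :> R.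
    by rewrite -expRM_natl; congr expR; lra.
  have h4 : (1 - x / 2) ^+ 2 <= expR (- (x / 2)) ^+ 2.
    by rewrite lerXn2r// nnegrE ?expR_ge0// ltW.
  have h5 : 0 <= 1 + x + x ^+ 2 by nra.
  apply: (@le_trans _ _ ((1 + x + x ^+ 2) * (1 - x / 2) ^+ 2)); last first.
    exact: ler_wpM2l.
  (* The product [(1 + x + x ^+ 2) * (1 - x / 2) ^+ 2] equals
     [1 + x ^+ 2 * (1 - 3 * x + x ^+ 2) / 4]; the bound [x < 1/3] makes the last factor
     nonnegative. *)
  have h6 : 0 <= 1 - 3 * x + x ^+ 2 by nra.
  have h7 : 0 <= x ^+ 2 * (1 - 3 * x + x ^+ 2) by rewrite mulr_ge0// sqr_ge0.
  lra.
have h8 : 1 + 3 * x ^+ 2 <= expR (3 * x ^+ 2) := expR_ge1Dx _.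
have h9 : 0 <= x ^+ 2 by exact: sqr_ge0.
lra.
Qed.

(** The linear part of the previous bound has mean zero. Since the mean and every value lie in
    [[-T, T]], their difference is at most [2 * T], and [3 * (2 * T) ^+ 2] gives the constant 12. *)
Lemma sum_expR_centered_le (R : realType) (K : finType) (p x : K -> R)
    (T tau : R) :
  (forall v, 0 <= p v) -> \sum_v p v = 1 -> (forall v, `|x v| <= T) ->
  \sum_v p v * expR (tau * (\sum_u p u * x u - x v)) <=
    expR (12 * tau ^+ 2 * T ^+ 2).
Proof.
move=> p0 p1 xT; set mu := \sum_u p u * x u.
have muT : `|mu| <= T.
  apply: le_trans (ler_norm_sum _ _ _) _.
  apply: (@le_trans _ _ (\sum_u p u * T)); last by rewrite -mulr_suml p1 mul1r.
  by apply: ler_sum => u _; rewrite normrM (ger0_norm (p0 u)) ler_wpM2l.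
apply: (@le_trans _ _
    (\sum_v p v * (tau * (mu - x v) + expR (12 * tau ^+ 2 * T ^+ 2)))).
  apply: ler_sum => v _; apply: ler_wpM2l => //.
  apply: le_trans (expR_le_add_expR_sqr _) _; rewrite lerD2l ler_expR.
  have : (mu - x v) ^+ 2 <= (2 * T) ^+ 2.
    rewrite -real_normK ?num_real// ler_sqr ?nnegrE ?mulr_ge0//; last first.
      by apply: le_trans muT; exact: normr_ge0.
    by apply: le_trans (ler_normB _ _) _; have := xT v; lra.
  move=> h; rewrite exprMn; have := ler_wpM2l (sqr_ge0 tau) h; nra.
under eq_bigr do rewrite mulrDr.
rewrite big_split/= -mulr_suml p1 mul1r gerDr.
under eq_bigr do rewrite mulrCA mulrBr.
by rewrite -mulr_sumr sumrB -mulr_suml p1 mul1r subrr mulr0.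
Qed.

(** Chernoff's method: the indicator of the lower tail is dominated by an exponential, whose mean
    under the product weights is an [n]-th power. *)
Lemma hoeffding_finite (R : realType) (K : finType) (n : nat) (p x : K -> R)
    (T t : R) :
  (forall v, 0 <= p v) -> \sum_v p v = 1 -> (forall v, `|x v| <= T) ->
  0 < T -> 0 <= t ->
  \sum_(v : {ffun 'I_n -> K} |
        \sum_(i < n) x (v i) < n%:R * (\sum_u p u * x u - t))
    \prod_(i < n) p (v i) <= expR (- (n%:R * t ^+ 2 / (48 * T ^+ 2))).
Proof.
move=> p0 p1 xT T0 t0; set mu := \sum_u p u * x u.
(* minimizes the exponent 12 tau^2 T^2 - tau t of the Chernoff bound *)
pose tau := t / (24 * T ^+ 2).
have tau0 : 0 <= tau by rewrite divr_ge0// mulr_ge0// sqr_ge0.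
apply: (@le_trans _ _ (\sum_(v : {ffun 'I_n -> K})
    \prod_(i < n) (p (v i) * expR (tau * (mu - x (v i))) * expR (- (tau * t))))).
  rewrite big_mkcond; apply: ler_sum => v _; case: ifPn => [vbad|_]; last first.
    by apply: prodr_ge0 => i _; rewrite !mulr_ge0// expR_ge0.
  (* On the bad event the sum of the terms [mu - t - x (v i)] is positive, so the exponential factor
     is at least 1. *)
  rewrite [leRHS](_ : _ = \prod_(i < n) p (v i) *
      expR (\sum_(i < n) tau * (mu - t - x (v i)))).
    rewrite ler_peMr ?prodr_ge0// -[leLHS]expR0 ler_expR -mulr_sumr mulr_ge0// sumrB.
    by rewrite sumr_const card_ord -[_ *+ n]mulr_natl subr_ge0 ltW.
  rewrite expR_sum -big_split/=; apply: eq_bigr => i _.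
  by rewrite -mulrA -expRD; congr (_ * expR _); ring.
(* Independence in finite form: the sum over all [v] of a product over coordinates is the product of
   the one-coordinate sums. *)
rewrite -(bigA_distr_bigA (fun _ v => p v * expR (tau * (mu - x v)) *
  expR (- (tau * t)))) prodr_const card_ord -mulr_suml.
have e0 : 0 <= \sum_v p v * expR (tau * (mu - x v)).
  by apply: sumr_ge0 => v _; rewrite mulr_ge0// expR_ge0.
apply: (@le_trans _ _
    ((expR (12 * tau ^+ 2 * T ^+ 2) * expR (- (tau * t))) ^+ n)).
  rewrite lerXn2r ?nnegrE ?mulr_ge0 ?expR_ge0// ler_wpM2r ?expR_ge0//.
  exact: sum_expR_centered_le.
rewrite -expRD -expRM_natl ler_expR.
have T2 : T != 0 by rewrite gt_eqF.
by rewrite /tau le_eqVlt; apply/orP; left; apply/eqP; field.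
Qed.

(** * Probabilities of events on the sample and the signs *)

Lemma measure_bigcup_finType d (T : measurableType d) (R : realType)
    (mu : {measure set T -> \bar R}) (K : finType) (D : pred K)
    (F : K -> set T) :
  (forall k, measurable (F k)) -> trivIset setT F ->
  mu (\bigcup_(k in [set` D]) F k) = (\sum_(k | D k) mu (F k))%E.
Proof.
move=> mF tF; rewrite measure_fin_bigcup//; last exact: sub_trivIset tF.
rewrite -[RHS]big_enum/= [RHS]fsbig_seq ?enum_uniq//.
by apply: eq_fsbigl; apply/seteqP; split => k /=; rewrite mem_enum.
Qed.

(** The independence hypothesis fixes every sign exactly. The event is therefore split disjointly
    over the admissible sign vectors, and the resulting sum of products is refolded into a product
    of sums. *)
Lemma iid_sample_signs_prob d (Omega : measurableType d) (R : realType)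
    (m n : nat) (P : probability Omega R) (P0 : probability (Zsp R m) R)
    (Zs : 'I_n -> Omega -> Zsp R m) (sg : 'I_n -> Omega -> bool)
    (A : 'I_n -> set (Zsp R m)) (B : 'I_n -> pred bool) :
  iid_sample_signs P P0 Zs sg -> (forall i, measurable (A i)) ->
  P (\bigcap_(i in [set: 'I_n]) [set om | A i (Zs i om) /\ B i (sg i om)]) =
  (\prod_(i < n) \sum_(b | B i b) (fine (P0 (A i)) / 2))%:E.
Proof.
move=> [mZ msg indep] mA.
pose F (b : {ffun 'I_n -> bool}) := \bigcap_(i in [set: 'I_n])
  [set om | A i (Zs i om) /\ sg i om = b i].
have mF b : measurable (F b).
  apply: fin_bigcap_measurable => // i _.
  have -> : [set om | A i (Zs i om) /\ sg i om = b i] =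
      (setT `&` Zs i @^-1` A i) `&` (setT `&` sg i @^-1` [set b i]).
    by rewrite !setTI.
  by apply: measurableI; [exact: mZ|exact: msg].
rewrite [X in P X](_ : _ = \bigcup_(b in [set` family B]) F b); last first.
  apply/seteqP; split => om.
    move=> h; exists [ffun i => sg i om].
      by apply/familyP => i; rewrite ffunE; case: (h i I).
    by move=> i _; rewrite ffunE; case: (h i I).
  by move=> [b /familyP bB Fb] i _; case: (Fb i I) => ? /= ->; split=> //; exact: bB.
rewrite measure_bigcup_finType//; last first.
  move=> b c _ _ [om [Fb Fc]]; apply/ffunP => i.
  by case: (Fb i I) => _ <-; case: (Fc i I).
rewrite (bigA_distr_big_dep B (fun i _ => fine (P0 (A i)) / 2)) -sumEFin.
by apply: eq_bigr => b _; exact: indep.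
Qed.

Lemma iid_sample_prob d (Omega : measurableType d) (R : realType)
    (m n : nat) (P : probability Omega R) (P0 : probability (Zsp R m) R)
    (Zs : 'I_n -> Omega -> Zsp R m) (sg : 'I_n -> Omega -> bool)
    (A : 'I_n -> set (Zsp R m)) :
  iid_sample_signs P P0 Zs sg -> (forall i, measurable (A i)) ->
  P (\bigcap_(i in [set: 'I_n]) Zs i @^-1` A i) =
  (\prod_(i < n) fine (P0 (A i)))%:E.
Proof.
move=> iid mA.
rewrite [X in P X](_ : _ = \bigcap_(i in [set: 'I_n])
    [set om | A i (Zs i om) /\ predT (sg i om)]); last first.
  by apply: eq_bigcapr => i _; apply/seteqP; split => om /=; [|case].
rewrite (iid_sample_signs_prob (fun=> predT) iid mA); congr EFin.
by apply: eq_bigr => i _; rewrite big_bool/= -splitr.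
Qed.

(** All coordinates other than [i] are left unconstrained and contribute a factor 1. The remaining
    [1 / 2] is what makes the two sign halves indistinguishable for [Zs i]. *)
Lemma sample_sign_prob d (Omega : measurableType d) (R : realType)
    (m n : nat) (P : probability Omega R) (P0 : probability (Zsp R m) R)
    (Zs : 'I_n -> Omega -> Zsp R m) (sg : 'I_n -> Omega -> bool)
    (i : 'I_n) (b : bool) (A : set (Zsp R m)) :
  iid_sample_signs P P0 Zs sg -> measurable A ->
  P (Zs i @^-1` A `&` sg i @^-1` [set b]) = (fine (P0 A) / 2)%:E.
Proof.
move=> iid mA.
pose A' j := if j == i then A else setT.
pose B j : pred bool := if j == i then pred1 b else predT.
rewrite [X in P X](_ : _ = \bigcap_(j in [set: 'I_n])
    [set om | A' j (Zs j om) /\ B j (sg j om)]); last first.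
  rewrite /A' /B; apply/seteqP; split => om.
    move=> [Ai bi] j _ /=; case: eqP => [->|//]; split => //=.
    exact/eqP.
  by move=> /(_ i I) /=; rewrite eqxx => -[Ai /= /eqP].
rewrite (iid_sample_signs_prob _ iid); last first.
  by move=> j; rewrite /A'; case: ifP.
rewrite (bigD1 i)//= [X in _ * X]big1 ?mulr1; last first.
  move=> j /negbTE ji; rewrite /A' /B ji big_bool/= probability_setT/=.
  by rewrite -splitr.
by rewrite /A' /B eqxx big_pred1_eq.
Qed.

(** * Measurability of the surrogate *)

Lemma measurable_fun_superlevel d (T : measurableType d) (R : realType)
    (f : T -> \bar R) :
  (forall a : R, measurable [set x | (a%:E < f x)%E]) -> measurable_fun setT f.
Proof.
move=> mf; apply: (measurability _ (ErealGenOInfty.measurableE R)).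
move=> _ [_ [a ->] <-]; rewrite setTI.
rewrite (_ : _ @^-1` _ = [set x | (a%:E < f x)%E]) //.
by apply/seteqP; split => x /=; rewrite in_itv/= andbT.
Qed.

(** An open set is the union of the rational boxes that it contains; there are countably many of
    them and each is measurable for the product structure. *)
Lemma measurable_box_open (R : realType) (m : nat) (U : set (Zsp R m)) :
  (forall z, U z -> exists2 e : R, 0 < e & forall z' : Zsp R m,
     (forall j, `|tnth z'.1 j - tnth z.1 j| < e) -> `|z'.2 - z.2| < e -> U z') ->
  measurable U.
Proof.
move=> oU.
pose box (k : (m.-tuple rat * rat) * rat) : set (Zsp R m) :=
  (\bigcap_(j in [set: 'I_m])
    ((fun z : Zsp R m => tnth z.1 j) @^-1` ball (ratr (tnth k.1.1 j) : R) (ratr k.2)))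
  `&` (snd @^-1` ball (ratr k.1.2 : R) (ratr k.2)).
have mbox k : measurable (box k).
  apply: measurableI.
    apply: fin_bigcap_measurable => // j _; rewrite -[X in measurable X]setTI.
    apply: (measurableT_comp (measurable_tnth j) measurable_fst) => //.
    by rewrite ball_itv; exact: measurable_itv.
  by rewrite -[X in measurable X]setTI; apply: measurable_snd => //;
    by rewrite ball_itv; exact: measurable_itv.
rewrite (_ : U = \bigcup_(k in [set k | box k `<=` U]) box k).
  rewrite bigcup_mkcond; apply: countable_bigcupT_measurable => [|k].
    exact: countableP.
  by case: ifP.
rewrite eqEsubset; split => [z Uz|z [k kU kz]]; last exact: kU.
have [e e0 eU] := oU z Uz.
(* A box of radius [r] whose center is within [r] of [z] contains [z] and stays within [2 * r < e]
   of it. *)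
have [|r] := @rat_in_itvoo R 0 (e / 2); first by rewrite divr_gt0.
rewrite in_itv/= => /andP[r0 re].
have approx (x : R) : exists q : rat, `|ratr q - x| < ratr r.
  have [|q] := @rat_in_itvoo _ (x - ratr r) (x + ratr r); first by lra.
  by rewrite in_itv/= => /andP[q1 q2]; exists q; rewrite ltr_distl q1.
have /choice[q qz] := fun j => approx (tnth z.1 j).
have [q0 q0z] := approx z.2.
exists (([tuple q j | j < m], q0), r).
  move=> z' /= [z'1 z'2]; apply: eU => [j|].
    have := z'1 j I; rewrite /ball/= tnth_mktuple => zq; have := qz j.
    rewrite !ltr_distl in zq *; lra.
  move: z'2; rewrite /ball/= !ltr_distl; rewrite ltr_distl in q0z; lra.
split => [j _|] /=; rewrite /ball/= ?tnth_mktuple; [exact: qz|exact: q0z].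
Qed.

(** A one-sided local Lipschitz bound, enough for lower semicontinuity of the surrogate. In each
    coordinate the cross term of the square is at most [2 * |a - b| * e], and the square of the
    displacement is at most [e ^+ 2 <= e], hence the shape of [C]. *)
Lemma cw_le_near (R : realType) (m : nat) (w : 'rV[R]_m.+1) (xi z : Zsp R m) :
  exists2 C : R, 0 <= C & forall (e : R) (z' : Zsp R m), 0 <= e <= 1 ->
    (forall j, `|tnth z'.1 j - tnth z.1 j| <= e) -> `|z'.2 - z.2| <= e ->
    cw w xi z' <= cw w xi z + C * e.
Proof.
pose C u (a b : R) := u ^+ 2 * (2 * `|a - b| + 1).
have C0 u a b : 0 <= C u a b.
  by rewrite mulr_ge0 ?sqr_ge0// addr_ge0// mulr_ge0.
have term u a b b' e : 0 <= e <= 1 -> `|b' - b| <= e ->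
    (u * (a - b')) ^+ 2 <= (u * (a - b)) ^+ 2 + C u a b * e.
  move=> /andP[e0 e1] be; rewrite !exprMn /C -mulrA -mulrDr.
  rewrite ler_wpM2l ?sqr_ge0//.
  have h1 : - ((a - b) * (b' - b)) <= `|a - b| * e.
    by apply: le_trans (ler_norm _) _; rewrite normrN normrM ler_wpM2l.
  have h2 : (b' - b) ^+ 2 <= e.
    rewrite -real_normK ?num_real//.
    by apply: (@le_trans _ _ (e ^+ 2)); [rewrite lerXn2r ?nnegrE|nra].
  nra.
exists (\sum_(j < m) C (w 0 (widen_ord (leqnSn m) j)) (tnth xi.1 j) (tnth z.1 j)
    + C (w 0 ord_max) xi.2 z.2).
  by rewrite addr_ge0// sumr_ge0.
move=> e z' e01 z1 z2; rewrite /cw mulrDl addrACA mulr_suml -big_split/=.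
by apply: lerD; [apply: ler_sum => j _|]; exact: term.
Qed.

(* For fixed xi the function z |-> l(xi) - lam c_w(xi,z) is continuous, so the
   superlevel sets of the (uncountable) supremum are open. *)
Lemma measurable_surrogate (R : realType) (m : nat) (Zset : set (Zsp R m))
    (f : 'rV[R]_m -> m.-tuple R -> R) (L : R -> R -> R) (w : 'rV[R]_m.+1)
    (lam : R) (theta : 'rV[R]_m) :
  0 <= lam -> measurable_fun setT (surrogate Zset f L w lam theta).
Proof.
move=> lam0; apply: measurable_fun_superlevel => a.
apply: measurable_box_open => z.
move=> /ereal_sup_gt[_ [xi Zxi <-]]; rewrite lte_fin => az.
have [C C0 hC] := cw_le_near w xi z.
set b := loss f L theta xi - lam * cw w xi z in az.
have D0 : 0 < lam * C + 1 by rewrite ltr_wpDl// mulr_ge0.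
(* The cost grows by at most [C * e], and [lam * C * e < (lam * C + 1) * e <= b - a]. The added 1
   keeps the denominator positive and the inequality strict. *)
pose e := Num.min 1 ((b - a) / (lam * C + 1)).
have e0 : 0 < e by rewrite lt_min ltr01 divr_gt0// subr_gt0.
exists e => // z' z1 z2; rewrite /=.
apply: (@lt_le_trans _ _ (loss f L theta xi - lam * cw w xi z')%:E); last first.
  by apply: ereal_sup_ubound; exists xi.
have e1 : 0 <= e <= 1 by rewrite ltW//= ge_min lexx.
have := hC e z' e1 (fun j => ltW (z1 j)) (ltW z2).
have : e * (lam * C + 1) <= b - a by rewrite -ler_pdivlMr// ge_min lexx orbT.
move=> h1 h2; have := ler_wpM2l lam0 h2; rewrite lte_fin /b in h1 az *; nra.
Qed.

(** * Nonnegativity of the Rademacher complexity *)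

(* No measurability: a supremum over theta need not be measurable. *)
Lemma le_integralT d (T : measurableType d) (R : realType)
    (mu : {measure set T -> \bar R}) (f g : T -> \bar R) :
  (forall x, f x <= g x)%E -> (\int[mu]_x f x <= \int[mu]_x g x)%E.
Proof.
(* For nonnegative integrands the integral is a supremum over simple minorants, and this family only
   grows with the integrand. *)
have mono (f' g' : T -> \bar R) : (forall x, 0 <= f' x)%E ->
    (forall x, f' x <= g' x)%E -> (\int[mu]_x f' x <= \int[mu]_x g' x)%E.
  move=> f0 fg; rewrite !ge0_integralTE//; last first.
    by move=> x; exact: le_trans (fg x).
  apply: ge_ereal_sup => _ [h hf <-]; apply: ereal_sup_ubound.
  by exists h => // x; exact: le_trans (fg x).
move=> fg; rewrite integralE [leRHS]integralE; apply: leeB; apply: mono => // x.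
  by rewrite !funeposE ge_max !le_max fg lexx orbT.
by rewrite !funenegE ge_max !le_max leeN2 fg lexx orbT.
Qed.

(** The restrictions of [P] to [D] and to [E] have the same image under [X], and each side is an
    integral of [f] against that image measure. *)
Lemma integral_preimage_eq d d' (Omega : measurableType d)
    (T : measurableType d') (R : realType) (P : {measure set Omega -> \bar R})
    (X : Omega -> T) (D E : set Omega) (f : T -> \bar R) :
  measurable_fun setT X -> measurable D -> measurable E ->
  measurable_fun setT f ->
  (forall A, measurable A -> P (X @^-1` A `&` D) = P (X @^-1` A `&` E)) ->
  (\int[P]_(om in D) f (X om) = \int[P]_(om in E) f (X om))%E.
Proof.
move=> mX mD mE mf DE.
have ge0 (g : T -> \bar R) : measurable_fun setT g -> (forall x, 0 <= g x)%E ->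
    (\int[P]_(om in D) g (X om) = \int[P]_(om in E) g (X om))%E.
  move=> mg g0.
  have key F (mF : measurable F) : (\int[P]_(om in F) g (X om) =
      \int[pushforward (mrestr P mF) X]_x g x)%E.
    rewrite [RHS]ge0_integral_pushforward// preimage_setT.
    rewrite [RHS](@ge0_negligible_integral _ _ _ _ setT (~` F))//=; last first.
    - by rewrite /mrestr setICl measure0.
    - exact: measurableT_comp.
    - exact: measurableC.
    rewrite setTD setCK; apply: eq_measure_integral => A mA AF.
    by rewrite /= /mrestr setIidl.
  rewrite !key; apply: eq_measure_integral => A mA _.
  exact: DE.
have pos om : ((fun om => f (X om))^\+ om = f^\+ (X om))%E by rewrite !funeposE.
have neg om : ((fun om => f (X om))^\- om = f^\- (X om))%E by rewrite !funenegE.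
rewrite integralE [RHS]integralE; congr (_ - _)%E.
- under eq_integral do rewrite pos.
  under [RHS]eq_integral do rewrite pos.
  by apply: ge0 => //; exact: measurable_funepos.
- under eq_integral do rewrite neg.
  under [RHS]eq_integral do rewrite neg.
  by apply: ge0 => //; exact: measurable_funeneg.
Qed.

(** [X] has the same law on the halves where the sign is positive and negative, so the two halves
    contribute opposite finite integrals. *)
Lemma integral_sgn_eq0 d d' (Omega : measurableType d) (T : measurableType d')
    (R : realType) (P : probability Omega R) (Q : probability T R)
    (X : Omega -> T) (s : Omega -> bool) (g : T -> R) :
  measurable_fun setT X -> measurable_fun setT s ->
  (forall b A, measurable A ->
    P (X @^-1` A `&` s @^-1` [set b]) = (fine (Q A) / 2)%:E) ->
  Q.-integrable setT (EFin \o g) ->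
  P.-integrable setT (fun om => (sgn R (s om) * g (X om))%:E) /\
  (\int[P]_om (sgn R (s om) * g (X om))%:E = 0)%E.
Proof.
move=> mX ms PQ ig.
have mg : measurable_fun setT g by exact/measurable_EFinP/measurable_int/ig.
have mD b : measurable (s @^-1` [set b]).
  by rewrite -[X in measurable X]setTI; exact: ms.
have sU : setT = s @^-1` [set true] `|` s @^-1` [set false].
  by apply/seteqP; split => // om _; case sb : (s om); [left|right].
have sI : [disjoint s @^-1` [set true] & s @^-1` [set false]].
  by apply/disj_setPS => om [/= ->].
(* Adding the two sign halves shows that [X] has law [Q], which transfers integrability from [g] to
   [g (X om)]. *)
have PX A : measurable A -> P (X @^-1` A) = Q A.
  move=> mA; rewrite -[X @^-1` A]setIT {1}sU setIUr measureU.
  - transitivity ((fine (Q A) / 2)%:E + (fine (Q A) / 2)%:E)%E.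
      by congr (_ + _)%E; exact: PQ.
    by rewrite -EFinD -splitr fineK// fin_num_measure.
  - by apply: measurableI => //; rewrite -[X in measurable X]setTI; exact: mX.
  - by apply: measurableI => //; rewrite -[X in measurable X]setTI; exact: mX.
  - by apply/seteqP; split => // om [[_ /= st] [_ /=]]; rewrite st.
have msg : measurable_fun setT (fun om => sgn R (s om)).
  by apply: measurable_fun_ifT.
have iX : P.-integrable setT (fun om => (g (X om))%:E).
  apply/integrableP; split.
    by apply/measurable_EFinP; exact: measurableT_comp.
  have /integrableP[_] := ig; rewrite (eq_measure_integral (pushforward P X)).
    rewrite ge0_integral_pushforward//.
    by apply: measurableT_comp => //; exact/measurable_EFinP.
  by move=> A mA _; symmetry; exact: PX.
have iXF : P.-integrable (s @^-1` [set false]) (fun om => (g (X om))%:E).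
  exact: (integrableS measurableT _ _ iX).
have iS : P.-integrable setT (fun om => (sgn R (s om) * g (X om))%:E).
  apply: (le_integrable measurableT _ _ iX).
    apply/measurable_EFinP; apply: measurable_funM => //.
    exact: measurableT_comp.
  move=> om _; rewrite /= lee_fin normrM.
  by rewrite /sgn; case: (s om); rewrite ?normrN1 ?normr1 mul1r.
split => //; rewrite sU integral_setU_EFin//; last first.
  by apply/measurable_EFinP; apply: measurable_int; rewrite -sU; exact: iS.
have -> : (\int[P]_(om in s @^-1` [set true]) (sgn R (s om) * g (X om))%:E =
    \int[P]_(om in s @^-1` [set true]) (g (X om))%:E)%E.
  by apply: eq_integral => om /set_mem /= ->; rewrite mul1r.
have -> : (\int[P]_(om in s @^-1` [set false]) (sgn R (s om) * g (X om))%:E =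
    - \int[P]_(om in s @^-1` [set false]) (g (X om))%:E)%E.
  rewrite -integralN; last first.
    exact: integrable_add_def.
  by apply: eq_integral => om /set_mem /= ->; rewrite mulN1r.
rewrite (@integral_preimage_eq _ _ _ _ _ P X _ (s @^-1` [set false]) (EFin \o g))//.
- rewrite subee//; exact: integrable_fin_num.
- exact/measurable_EFinP.
- move=> A mA; transitivity (fine (Q A) / 2)%:E; [|symmetry]; exact: PQ.
Qed.

Lemma probability_bounded_integrable d (T : measurableType d) (R : realType)
    (P : probability T R) (D : set T) (g : T -> R) (C : R) :
  measurable D -> measurable_fun D g -> (forall x, D x -> `|g x| <= C) ->
  P.-integrable D (EFin \o g).
Proof.
move=> mD mg gC; apply: measurable_bounded_integrable => //.
  by apply: (le_lt_trans (probability_le1 _ mD)); exact: ltry.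
exists C; split; rewrite ?num_real// => y Cy x Dx.
exact: le_trans (gC x Dx) (ltW Cy).
Qed.

(** The class member at parameter 0 alone gives a signed average of mean zero below the supremum. *)
Lemma rademacher_ge0 (R : realType) (m : nat) (Zset : set (Zsp R m))
    (f : 'rV[R]_m -> m.-tuple R -> R) (L : R -> R -> R) (Tl : R)
    (P0 : probability (Zsp R m) R) (n : nat)
    (dO : measure_display) (Omega : measurableType dO) (P : probability Omega R)
    (Zs : 'I_n -> Omega -> Zsp R m) (sg : 'I_n -> Omega -> bool) :
  measurable Zset ->
  (forall theta, measurable_fun Zset (loss f L theta)) ->
  (forall theta (z : Zsp R m), Zset z -> `|loss f L theta z| <= Tl) ->
  P0 Zset = 1%E ->
  P0.-integrable Zset (fun z : Zsp R m => (L 0 z.2)%:E) ->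
  iid_sample_signs P P0 Zs sg ->
  (0 <= rademacher P Zs sg f L)%E.
Proof.
move=> mZ mloss lossT P0Z iL iid.
(* Extension by zero makes the function measurable everywhere; it changes the signed average only
   when a sample point leaves [Zset], a null event. *)
pose g : Zsp R m -> R := (fun z => loss f L 0 z - L 0 z.2) \_ Zset.
have ig : P0.-integrable setT (EFin \o g).
  have -> : EFin \o g = (EFin \o (fun z => loss f L 0 z - L 0 z.2)) \_ Zset.
    by apply/funext => z; rewrite /g/= !patchE; case: ifP.
  apply/(integrable_mkcond _ mZ).
  apply: (@integrableB _ _ _ P0 Zset mZ (EFin \o loss f L 0)
    (fun z => (L 0 z.2)%:E)) => //.
  exact: (@probability_bounded_integrable _ _ R P0 Zset (loss f L 0) Tl mZ
    (mloss 0) (lossT 0)).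
have [mX ms _] := iid.
have key i := integral_sgn_eq0 (mX i) (ms i)
  (fun b A mA => sample_sign_prob i b iid mA) ig.
pose E := \bigcap_(i in [set: 'I_n]) Zs i @^-1` Zset.
have mE : measurable E.
  apply: fin_bigcap_measurable => // i _; rewrite -[X in measurable X]setTI.
  exact: mX.
have PE : P E = 1%E.
  by rewrite (iid_sample_prob iid)// P0Z/= big1.
have PEC : P (~` E) = 0%E by rewrite probability_setC// PE subee.
pose h om := (n%:R^-1 * \sum_(i < n) sgn R (sg i om) * g (Zs i om))%:E.
have mh : measurable_fun setT h.
  apply/measurable_EFinP; apply: measurable_funM => //.
  apply: measurable_sum => i; apply/measurable_EFinP.
  exact: measurable_int (key i).1.
have h0 : (\int[P]_om h om = 0)%E.
  have hE om : h om = (n%:R^-1%:E *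
      \sum_(i < n) (sgn R (sg i om) * g (Zs i om))%:E)%E.
    by rewrite /h EFinM -sumEFin.
  under eq_integral do rewrite hE.
  rewrite integralZl//; last first.
    by apply: integrable_sum => // i _; exact: (key i).1.
  rewrite integral_sum//; last by move=> i; exact: (key i).1.
  by rewrite big1 ?mule0// => i _; exact: (key i).2.
(* h' is a measurable minorant of the supremum everywhere, also off E, where
   the loss need not be measurable. *)
pose h' om := if om \in E then h om else -oo%E.
have mh' : measurable_fun setT h'.
  apply: measurable_fun_ifT => //.
  apply: (measurable_fun_bool true); rewrite setTI (_ : _ @^-1` _ = E)//.
  by apply/seteqP; split => om /=; [move=> /set_mem|move=> /mem_set].
have -> : 0%E = (\int[P]_om h' om)%E.
  rewrite -h0; apply: ae_eq_integral => //.
  exists (~` E); split; first exact: measurableC.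
    exact: PEC.
  by move=> om /= nE Eom; apply: nE => _; rewrite /h' mem_set.
apply: le_integralT => om; rewrite /h'; case: ifPn => [/set_mem Eom|_]; last first.
  exact: leNye.
apply: ereal_sup_ubound; exists 0 => //.
rewrite /h; congr ((_ * _)%:E); apply: eq_bigr => i _.
by rewrite /g patchE mem_set//; exact: Eom.
Qed.

(** * Weak Kantorovich duality *)

Lemma measurable_cw (R : realType) (m : nat) (w : 'rV[R]_m.+1) :
  measurable_fun setT (fun p : Zsp R m * Zsp R m => cw w p.1 p.2).
Proof.
have m1 j : measurable_fun setT (fun p : Zsp R m * Zsp R m => tnth p.1.1 j).
  apply: (measurableT_comp (measurable_tnth j)).
  exact: (measurableT_comp measurable_fst measurable_fst).
have m2 j : measurable_fun setT (fun p : Zsp R m * Zsp R m => tnth p.2.1 j).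
  apply: (measurableT_comp (measurable_tnth j)).
  exact: (measurableT_comp measurable_fst measurable_snd).
apply: measurable_funD.
  apply: measurable_sum => j; apply: measurable_funX; apply: measurable_funM => //.
  exact: measurable_funB.
apply: measurable_funX; apply: measurable_funM => //; apply: measurable_funB.
  exact: (measurableT_comp measurable_snd measurable_fst).
exact: (measurableT_comp measurable_snd measurable_snd).
Qed.

Lemma cw_ge0 (R : realType) (m : nat) (w : 'rV[R]_m.+1) (z z' : Zsp R m) :
  0 <= cw w z z'.
Proof. by rewrite addr_ge0 ?sqr_ge0// sumr_ge0// => j _; rewrite sqr_ge0. Qed.

(* Shifting by C makes the integrands nonnegative, so that no integrability of
   the cost is needed in integral_le_coupling. *)
Lemma integral_bounded_shift d (T : measurableType d) (R : realType)
    (P : probability T R) (D : set T) (g : T -> R) (C : R) :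
  measurable D -> P D = 1%E -> measurable_fun D g ->
  (forall x, D x -> `|g x| <= C) ->
  (\int[P]_(x in D) (g x)%:E \is a fin_num)%E /\
  (\int[P]_x (((fun x => g x + C) \_ D) x)%:E =
   \int[P]_(x in D) (g x)%:E + C%:E)%E.
Proof.
move=> mD PD mg gC.
have ig : P.-integrable D (EFin \o g).
  exact: probability_bounded_integrable gC.
split; first exact: (integrable_fin_num mD ig).
transitivity (\int[P]_(x in D) ((g x)%:E + (cst C x)%:E))%E.
  rewrite [RHS]integral_mkcond; apply: eq_integral => x _.
  by rewrite !patchE; case: ifP.
rewrite integralD//=; last first.
  by apply: finite_measure_integrable_cst.
by rewrite integral_cst//; congr (_ + _)%E; rewrite -[RHS]mule1 -PD.
Qed.

(** The marginals of [M] turn both one-variable integrals into integrals against [M], where the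
    pointwise inequality can be integrated. It can fail only when a component leaves [D], which is
    [M]-null. *)
Lemma integral_le_coupling d (T : measurableType d) (R : realType)
    (Q P0 : probability T R) (M : probability (T * T)%type R) (D : set T)
    (g phi : T -> R) (c : T -> T -> R) (C : R) :
  is_coupling Q P0 M -> measurable D -> Q D = 1%E -> P0 D = 1%E ->
  measurable_fun D g -> measurable_fun D phi ->
  measurable_fun setT (fun p : T * T => c p.1 p.2) ->
  (forall x y, 0 <= c x y) ->
  (forall x, D x -> `|g x| <= C) -> (forall x, D x -> `|phi x| <= C) ->
  (forall x y, D x -> D y -> g x <= phi y + c x y) ->
  (\int[Q]_(x in D) (g x)%:E <=
   \int[P0]_(x in D) (phi x)%:E + \int[M]_p (c p.1 p.2)%:E)%E.
Proof.
move=> cM mD QD P0D mg mphi mc c0 gC phiC gphi.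
have [_ ug] := integral_bounded_shift mD QD mg gC.
have [pfin vphi] := integral_bounded_shift mD P0D mphi phiC.
set u := (fun x => g x + C) \_ D in ug.
set v := (fun x => phi x + C) \_ D in vphi.
have u0 x : 0 <= u x.
  rewrite /u patchE; case: ifPn => // /set_mem Dx.
  by have := gC _ Dx; rewrite ler_norml; lra.
have v0 x : 0 <= v x.
  rewrite /v patchE; case: ifPn => // /set_mem Dx.
  by have := phiC _ Dx; rewrite ler_norml; lra.
have mu : measurable_fun setT (fun x => (u x)%:E).
  apply/measurable_EFinP; apply/(measurable_restrictT _ mD).
  exact: measurable_funD.
have mv : measurable_fun setT (fun x => (v x)%:E).
  apply/measurable_EFinP; apply/(measurable_restrictT _ mD).
  exact: measurable_funD.
have muM : measurable_fun setT (fun p : T * T => (u p.1)%:E).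
  exact: (measurableT_comp mu measurable_fst).
have mvM : measurable_fun setT (fun p : T * T => (v p.2)%:E).
  exact: (measurableT_comp mv measurable_snd).
have mcM : measurable_fun setT (fun p : T * T => (c p.1 p.2)%:E).
  exact/measurable_EFinP.
have uQ : (\int[Q]_x (u x)%:E = \int[M]_p (u p.1)%:E)%E.
  rewrite (eq_measure_integral (pushforward M fst)).
    by rewrite ge0_integral_pushforward// => x _; rewrite lee_fin.
  by move=> A mA _; symmetry; exact: (cM A mA).1.
have vP : (\int[P0]_x (v x)%:E = \int[M]_p (v p.2)%:E)%E.
  rewrite (eq_measure_integral (pushforward M snd)).
    by rewrite ge0_integral_pushforward// => x _; rewrite lee_fin.
  by move=> A mA _; symmetry; exact: (cM A mA).2.
rewrite -(@leeD2rE _ C%:E)// -ug addeAC -vphi uQ vP -ge0_integralD//; last 2 first.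
- by move=> x _; rewrite lee_fin.
- by move=> x _; rewrite lee_fin.
apply: ae_ge0_le_integral => //.
- by move=> x _; rewrite lee_fin.
- by move=> x _; rewrite adde_ge0 ?lee_fin.
- exact: emeasurable_funD.
have mDC : measurable (~` D) := measurableC mD.
have QN : M (fst @^-1` (~` D)) = 0%E.
  transitivity (Q (~` D)); first exact: (cM _ mDC).1.
  by rewrite probability_setC// QD subee.
have PN : M (snd @^-1` (~` D)) = 0%E.
  transitivity (P0 (~` D)); first exact: (cM _ mDC).2.
  by rewrite probability_setC// P0D subee.
have mN1 : measurable (fst @^-1` (~` D) : set (T * T)).
  by rewrite -[X in measurable X]setTI; exact: measurable_fst.
have mN2 : measurable (snd @^-1` (~` D) : set (T * T)).
  by rewrite -[X in measurable X]setTI; exact: measurable_snd.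
exists (fst @^-1` (~` D) `|` snd @^-1` (~` D)); split.
- exact: measurableU.
- by apply: null_set_setU.
move=> p /=; apply: contra_notP => /not_orP[/contrapT D1 /contrapT D2] _.
rewrite -EFinD lee_fin /u /v !patchE !mem_set//.
by have := gphi _ _ D1 D2; lra.
Qed.

(** The dual potential [phi] is left free so that a finitely valued majorant of the surrogate can be
    used in its place. *)
Lemma dro_risk_le_dual (R : realType) (m : nat) (Zset : set (Zsp R m))
    (f : 'rV[R]_m -> m.-tuple R -> R) (L : R -> R -> R) (w : 'rV[R]_m.+1)
    (P0 : probability (Zsp R m) R) (rho lam C : R) (theta : 'rV[R]_m)
    (phi : Zsp R m -> R) :
  measurable Zset -> P0 Zset = 1%E -> 0 <= lam ->
  measurable_fun Zset (loss f L theta) -> measurable_fun Zset phi ->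
  (forall z, Zset z -> `|loss f L theta z| <= C) ->
  (forall z, Zset z -> `|phi z| <= C) ->
  (forall z z', Zset z -> Zset z' ->
    loss f L theta z <= phi z' + lam * cw w z z') ->
  (dro_risk Zset f L w P0 rho theta <=
   (lam * rho)%:E + \int[P0]_(z in Zset) (phi z)%:E)%E.
Proof.
move=> mZ P0Z lam0 ml mphi lC phiC lphi.
apply: ge_ereal_sup => _ [Q [QZ WQ] <-].
apply/lee_addgt0Pr => e e0.
have l1 : 0 < lam + 1 by rewrite ltr_wpDl.
(* The infimum over couplings may not be attained, so a nearly optimal one is taken. The excess
   costs [lam * e / (lam + 1) <= e], and the added 1 covers [lam = 0]. *)
have : (wasserstein (cw w) Q P0 < (rho + e / (lam + 1))%:E)%E.
  by apply: le_lt_trans WQ _; rewrite lte_fin ltrDl divr_gt0.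
move=> /ereal_inf_lt[_ [M cM <-] Mc].
have mcw := measurable_cw w.
have mlc : measurable_fun setT (fun p : Zsp R m * Zsp R m => lam * cw w p.1 p.2).
  exact: measurable_funM.
have lc0 z z' : 0 <= lam * cw w z z' by rewrite mulr_ge0// cw_ge0.
apply: (le_trans (integral_le_coupling cM mZ QZ P0Z ml mphi mlc lc0 lC phiC lphi)).
rewrite [leRHS]addeAC [leLHS]addeC; apply: leeD => //.
under eq_integral do rewrite EFinM.
rewrite ge0_integralZl_EFin//; last 2 first.
- by move=> p _; rewrite lee_fin cw_ge0.
- exact/measurable_EFinP.
apply: (@le_trans _ _ (lam%:E * (rho + e / (lam + 1))%:E)%E).
  by rewrite lee_wpmul2l// ltW.
rewrite -EFinM -EFinD lee_fin mulrDr lerD2l mulrCA ger_pMr// ler_pdivrMr//; lra.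
Qed.

(** * Discretization and concentration of the surrogate *)

Lemma measurable_sum_indic d (T : measurableType d) (R : realType)
    (K : finType) (D : set T) (A : K -> set T) (y : K -> R) :
  (forall k, measurable (A k)) ->
  measurable_fun D (fun x => \sum_k y k * \1_(A k) x).
Proof.
by move=> mA; apply: measurable_sum => k; apply: measurable_funM.
Qed.

Lemma integral_sum_indic d (T : measurableType d) (R : realType)
    (P : probability T R) (K : finType) (D : set T) (A : K -> set T)
    (y : K -> R) :
  measurable D -> (forall k, measurable (A k)) -> (forall k, A k `<=` D) ->
  (\int[P]_(x in D) (\sum_k y k * \1_(A k) x)%:E =
   (\sum_k fine (P (A k)) * y k)%:E)%E.
Proof.
move=> mD mA AD.
have iA k : P.-integrable D (fun x => (\1_(A k) x)%:E).
  apply: (@probability_bounded_integrable _ _ _ P D (\1_(A k)) 1) => //.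
  by move=> x _; rewrite indicE; case: (_ \in _); rewrite ?normr1 ?normr0.
have iyA k : P.-integrable D (fun x => ((y k)%:E * (\1_(A k) x)%:E)%E).
  exact: integrableZl.
transitivity (\int[P]_(x in D) (\sum_k (y k)%:E * (\1_(A k) x)%:E))%E.
  by apply: eq_integral => x _; rewrite -sumEFin; apply: eq_bigr.
rewrite integral_sum// -sumEFin; apply: eq_bigr => k _.
rewrite integralZl// integral_indic// setIidl// EFinM muleC fineK//.
by rewrite fin_num_measure.
Qed.

(** Recording the cell of each sample point gives disjoint events with product probabilities. [G]
    collects the good cell vectors, and the bad ones are bounded by [hoeffding_finite]. *)
Lemma iid_hoeffding_finite d (Omega : measurableType d) (R : realType)
    (m n : nat) (P : probability Omega R) (P0 : probability (Zsp R m) R)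
    (Zs : 'I_n -> Omega -> Zsp R m) (sg : 'I_n -> Omega -> bool)
    (K : finType) (A : K -> set (Zsp R m)) (x : K -> R) (T t : R) :
  iid_sample_signs P P0 Zs sg ->
  (forall k, measurable (A k)) -> trivIset setT A ->
  \sum_k fine (P0 (A k)) = 1 -> (forall k, `|x k| <= T) -> 0 < T -> 0 <= t ->
  exists G : set Omega, [/\ measurable G,
    ((1 - expR (- (n%:R * t ^+ 2 / (48 * T ^+ 2))))%:E <= P G)%E &
    forall om, G om -> exists2 v : 'I_n -> K, forall i, A (v i) (Zs i om) &
      n%:R * (\sum_k fine (P0 (A k)) * x k - t) <= \sum_(i < n) x (v i)].
Proof.
move=> iid mA tA p1 xT T0 t0.
pose p k := fine (P0 (A k)).
have p0 k : 0 <= p k by rewrite fine_ge0.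
have [mZ _ _] := iid.
pose F (v : {ffun 'I_n -> K}) := \bigcap_(i in [set: 'I_n]) Zs i @^-1` A (v i).
have mF v : measurable (F v).
  apply: fin_bigcap_measurable => // i _; rewrite -[X in measurable X]setTI.
  exact: mZ.
have tF : trivIset setT F.
  move=> u v _ _ [om [Fu Fv]]; apply/ffunP => i.
  by apply: tA => //; exists (Zs i om); split; [exact: Fu|exact: Fv].
pose good (v : {ffun 'I_n -> K}) :=
  n%:R * (\sum_k p k * x k - t) <= \sum_(i < n) x (v i).
exists (\bigcup_(v in [set` good]) F v); split.
- by apply: fin_bigcup_measurable => // v _; exact: mF.
- rewrite measure_bigcup_finType//.
  rewrite (eq_bigr (fun v : {ffun 'I_n -> K} => (\prod_(i < n) p (v i))%:E)).
    rewrite sumEFin lee_fin lerBlDr.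
    have S1 : \sum_(v : {ffun 'I_n -> K}) \prod_(i < n) p (v i) = 1.
      by rewrite -(bigA_distr_bigA (fun _ k => p k)) big1// => i _; exact: p1.
    rewrite -[leLHS]S1 [leLHS](bigID good)/= lerD2l.
    rewrite (eq_bigl (fun v : {ffun 'I_n -> K} =>
        \sum_(i < n) x (v i) < n%:R * (\sum_k p k * x k - t))).
      exact: hoeffding_finite.
    by move=> v; rewrite /good ltNge.
  by move=> v _; apply: (iid_sample_prob iid).
- by move=> om [v vgood Fv]; exists v => // i; exact: Fv.
Qed.

Lemma le_surrogate (R : realType) (m : nat) (Zset : set (Zsp R m))
    (f : 'rV[R]_m -> m.-tuple R -> R) (L : R -> R -> R) (w : 'rV[R]_m.+1)
    (lam : R) (theta : 'rV[R]_m) (xi z : Zsp R m) :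
  Zset xi -> ((loss f L theta xi - lam * cw w xi z)%:E <=
    surrogate Zset f L w lam theta z)%E.
Proof. by move=> Zxi; apply: ereal_sup_ubound; exists xi. Qed.

(** The choice [xi = z] has zero cost and gives the lower bound; nonnegativity of the cost gives the
    upper one. *)
Lemma surrogate_itv (R : realType) (m : nat) (Zset : set (Zsp R m))
    (f : 'rV[R]_m -> m.-tuple R -> R) (L : R -> R -> R) (w : 'rV[R]_m.+1)
    (lam T : R) (theta : 'rV[R]_m) (z : Zsp R m) :
  0 <= lam -> (forall xi, Zset xi -> `|loss f L theta xi| <= T) -> Zset z ->
  exists2 r : R, surrogate Zset f L w lam theta z = r%:E & - T <= r <= T.
Proof.
move=> lam0 lT Zz.
have lo : ((- T)%:E <= surrogate Zset f L w lam theta z)%E.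
  apply: le_trans (le_surrogate _ _ _ _ _ _ Zz); rewrite lee_fin.
  have -> : cw w z z = 0.
    rewrite /cw subrr mulr0 expr0n addr0 big1// => j _.
    by rewrite subrr mulr0 expr0n.
  by have := lT _ Zz; rewrite mulr0 subr0 ler_norml => /andP[].
have hi : (surrogate Zset f L w lam theta z <= T%:E)%E.
  apply: ge_ereal_sup => _ [xi Zxi <-]; rewrite lee_fin.
  have := lT _ Zxi; rewrite ler_norml => /andP[_].
  by apply: le_trans; rewrite gerBl mulr_ge0// cw_ge0.
case: (surrogate _ _ _ _ _ _ _) lo hi => [r| |]//.
by rewrite !lee_fin => lo hi; exists r => //; rewrite lo.
Qed.

(** The number [a] separates the two sides: it is the mean of the surrogate rounded up to a grid,
    and the rounded-down empirical mean is close to it with high probability. *)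
Lemma dro_risk_concentration (R : realType) (m : nat) (Zset : set (Zsp R m))
    (f : 'rV[R]_m -> m.-tuple R -> R) (L : R -> R -> R) (Tl : R)
    (P0 : probability (Zsp R m) R) (w : 'rV[R]_m.+1) (n : nat)
    (dO : measure_display) (Omega : measurableType dO) (P : probability Omega R)
    (Zs : 'I_n -> Omega -> Zsp R m) (sg : 'I_n -> Omega -> bool)
    (theta : 'rV[R]_m) (rho lam delta : R) :
  measurable Zset -> measurable_fun Zset (loss f L theta) ->
  (forall z, Zset z -> `|loss f L theta z| <= Tl) -> 0 < Tl ->
  P0 Zset = 1%E -> (0 < n)%N -> iid_sample_signs P P0 Zs sg ->
  0 <= lam -> 0 < delta < 1 ->
  exists G : set Omega, exists a : R, [/\ measurable G,
    ((1 - delta)%:E <= P G)%E,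
    (dro_risk Zset f L w P0 rho theta <= (lam * rho + a)%:E)%E &
    forall om, G om -> (a%:E <=
      n%:R^-1%:E * \sum_(i < n) surrogate Zset f L w lam theta (Zs i om) +
      (8 * Tl * Num.sqrt (ln delta^-1 / n%:R))%:E)%E].
Proof.
move=> mZ ml lT Tl0 P0Z n0 iid lam0 /andP[d0 d1].
pose s := surrogate Zset f L w lam theta.
have sitv z : Zset z -> exists2 r : R, s z = r%:E & - Tl <= r <= Tl.
  exact: surrogate_itv.
have nR0 : 0 < n%:R :> R by rewrite ltr0n.
have lnd0 : 0 < ln delta^-1 by rewrite ln_gt0// invf_gt1.
pose q := Num.sqrt (ln delta^-1 / n%:R).
have q0 : 0 < q by rewrite sqrtr_gt0 divr_gt0.
have q2 : q ^+ 2 = ln delta^-1 / n%:R by rewrite sqr_sqrtr// divr_ge0// ltW.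
(* With [N >= 2 / q] the grid step [eps] is at most [Tl * q]. *)
pose N := (Num.truncn (2 / q)).+1.
have N0 : 0 < N%:R :> R by rewrite ltr0n.
have Nq : 2 / q <= N%:R by rewrite ltW// truncnS_gt.
pose eps := 2 * Tl / N%:R.
have eps0 : 0 < eps by rewrite divr_gt0// mulr_gt0.
have epsq : eps <= Tl * q.
  rewrite ler_pdivrMr//; move: Nq; rewrite ler_pdivrMr// => Nq.
  by have := ler_wpM2l (ltW Tl0) Nq; lra.
have epsN : N%:R * eps = 2 * Tl by rewrite /eps mulrC divfK// gt_eqF.
(* There are [N + 1] grid points, from [- Tl] up to [Tl] included, because the surrogate may attain
   [Tl] and the cells are open on the right. *)
pose x (v : 'I_N.+1) : R := - Tl + v%:R * eps.
have xT v : `|x v| <= Tl.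
  have h1 : 0 <= v%:R * eps by rewrite mulr_ge0// ltW.
  have h2 : v%:R * eps <= N%:R * eps.
    by apply: ler_wpM2r; [exact: ltW|rewrite ler_nat -ltnS].
  by rewrite ler_norml /x; lra.
pose A (v : 'I_N.+1) := Zset `&`
  ([set z | ((x v)%:E <= s z)%E] `&` [set z | (s z < (x v + eps)%:E)%E]).
have ms : measurable_fun setT s by exact: measurable_surrogate.
have mA v : measurable (A v).
  apply: measurableI => //; apply: measurableI; rewrite -[X in measurable X]setTI.
    exact: emeasurable_fun_c_infty.
  exact: emeasurable_fun_infty_o.
have tA : trivIset setT A.
  have key u v z : A u z -> A v z -> (u <= v)%N.
    move=> [_ [/= su _]] [_ [_ /= sv]].
    have := le_lt_trans su sv; rewrite lte_fin /x -addrA ltrD2l.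
    by rewrite -[X in _ + X]mul1r -mulrDl ltr_pM2r// natr1 ltr_nat ltnS.
  move=> u v _ _ [z [Au Av]]; apply/val_inj/eqP.
  by rewrite eqn_leq (key _ _ _ Au Av) (key _ _ _ Av Au).
have AU : Zset = \bigcup_(v in [set` predT]) A v.
  apply/seteqP; split => [z Zz|z [v _ []]//].
  have [r sr /andP[r1 r2]] := sitv _ Zz.
  have rT0 : 0 <= (r + Tl) / eps by apply: divr_ge0; [lra|exact: ltW].
  have /andP[v1 v2] := truncn_itv rT0.
  have vN : (Num.truncn ((r + Tl) / eps) < N.+1)%N.
    rewrite ltnS -(ler_nat R); apply: le_trans v1 _.
    by rewrite ler_pdivrMr// epsN; lra.
  exists (Ordinal vN) => //; split => //; rewrite /x /= sr.
  rewrite ler_pdivlMr// in v1; rewrite ltr_pdivrMr// -natr1 in v2.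
  by split; rewrite ?lee_fin ?lte_fin; lra.
have p1 : \sum_v fine (P0 (A v)) = 1.
  apply: EFin_inj; rewrite -sumEFin -P0Z [in RHS]AU measure_bigcup_finType//.
  by apply: eq_bigr => v _; rewrite fineK// fin_num_measure.
pose mu := \sum_v fine (P0 (A v)) * x v.
(* Since [7 ^+ 2 = 49 >= 48], the Hoeffding exponent is at least [n * q ^+ 2 = ln (1 / delta)]. *)
pose t := 7 * Tl * q.
have t0 : 0 <= t by rewrite !mulr_ge0// ltW.
have [G [mG PG Gv]] := iid_hoeffding_finite iid mA tA p1 xT Tl0 t0.
exists G, (mu + eps); split => //.
- apply: le_trans PG; rewrite lee_fin lerD2l lerN2.
  rewrite -[leRHS](lnK _) ?posrE// ler_expR.
  have -> : ln delta = - (n%:R * q ^+ 2).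
    by rewrite q2 mulrCA divff ?gt_eqF// mulr1 lnV ?posrE// opprK.
  rewrite lerN2 ler_pdivlMr ?mulr_gt0 ?exprn_gt0// /t !exprMn.
  have : 0 <= n%:R * (Tl ^+ 2 * q ^+ 2) by rewrite !mulr_ge0 ?sqr_ge0// ltW.
  by lra.
(* The surrogate rounded up: it dominates the surrogate on [Zset], so it is an admissible dual
   potential, and its mean is [mu + eps]. *)
- pose phi z := \sum_v (x v + eps) * \1_(A v) z.
  have phiA v z : A v z -> phi z = x v + eps.
    move=> Av; rewrite /phi (bigD1 v)//= big1 ?addr0.
      by rewrite indicE mem_set// mulr1.
    move=> u uv; rewrite indicE memNset ?mulr0// => Au.
    by move/eqP: uv; apply; apply: tA => //; exists z.
  have -> : (lam * rho + (mu + eps))%:E =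
      ((lam * rho)%:E + \int[P0]_(z in Zset) (phi z)%:E)%E.
    rewrite integral_sum_indic//; last by move=> v z [].
    rewrite -EFinD; congr (_ + _)%:E.
    under [RHS]eq_bigr do rewrite mulrDr.
    by rewrite big_split/= -mulr_suml p1 mul1r.
  apply: (@dro_risk_le_dual _ _ _ _ _ _ _ _ _ (Tl + eps)) => //.
  + exact: measurable_sum_indic.
  + by move=> z Zz; apply: le_trans (lT _ Zz) _; rewrite lerDl ltW.
  + move=> z; rewrite AU => -[v _ Av]; rewrite (phiA _ _ Av).
    by apply: le_trans (ler_normD _ _) _; rewrite (gtr0_norm eps0) lerD2r.
  + move=> z z' Zz; rewrite {1}AU => -[v _ Av]; rewrite (phiA _ _ Av).
    case: Av => _ [_ /= sv].
    have := le_lt_trans (le_surrogate f L w lam theta z' Zz) sv.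
    by rewrite lte_fin; lra.
(* The rounded-down empirical mean is at least [mu - t], and [t + eps <= 8 * Tl * q]; undoing the
   rounding only raises the empirical mean. *)
- move=> om /Gv[v Av]; rewrite mulrC -ler_pdivlMr// => muv.
  apply: (@le_trans _ _ (n%:R^-1%:E * (\sum_(i < n) x (v i))%:E +
      (8 * Tl * q)%:E)%E).
    rewrite -EFinM -EFinD lee_fin mulrC; move: muv; rewrite -/mu /t; lra.
  apply: leeD => //; apply: lee_wpmul2l; first by rewrite lee_fin invr_ge0 ltW.
  by rewrite -sumEFin; apply: lee_sum => i _; case: (Av i) => _ [].
Qed.

(** For a zero bound the grid would collapse to step 0. The loss then vanishes on [Zset], so the
    zero potential is admissible and the good event is that all sample points lie in [Zset]. *)
Lemma dro_risk_concentration0 (R : realType) (m : nat) (Zset : set (Zsp R m))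
    (f : 'rV[R]_m -> m.-tuple R -> R) (L : R -> R -> R)
    (P0 : probability (Zsp R m) R) (w : 'rV[R]_m.+1) (n : nat)
    (dO : measure_display) (Omega : measurableType dO) (P : probability Omega R)
    (Zs : 'I_n -> Omega -> Zsp R m) (sg : 'I_n -> Omega -> bool)
    (theta : 'rV[R]_m) (rho lam : R) :
  measurable Zset -> measurable_fun Zset (loss f L theta) ->
  (forall z, Zset z -> `|loss f L theta z| <= 0) ->
  P0 Zset = 1%E -> iid_sample_signs P P0 Zs sg -> 0 <= lam ->
  exists G : set Omega, [/\ measurable G, P G = 1%E,
    (dro_risk Zset f L w P0 rho theta <= (lam * rho)%:E)%E &
    forall om, G om -> (0 <=
      n%:R^-1%:E * \sum_(i < n) surrogate Zset f L w lam theta (Zs i om))%E].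
Proof.
move=> mZ ml l0 P0Z iid lam0.
have [mX _ _] := iid.
exists (\bigcap_(i in [set: 'I_n]) Zs i @^-1` Zset); split.
- apply: fin_bigcap_measurable => // i _; rewrite -[X in measurable X]setTI.
  exact: mX.
- by rewrite (iid_sample_prob iid)// P0Z/= big1.
- rewrite -[leRHS]adde0 -(integral0 P0 Zset).
  apply: (@dro_risk_le_dual _ _ _ _ _ _ _ _ _ 0) => //.
    by move=> z _; rewrite normr0.
  move=> z z' Zz _; rewrite add0r; apply: le_trans (ler_norm _) _.
  by apply: le_trans (l0 _ Zz) _; rewrite mulr_ge0// cw_ge0.
- move=> om Zom; rewrite mule_ge0// ?lee_fin ?invr_ge0//.
  apply: sume_ge0 => i _.
  have [r -> /andP[r0 _]] := surrogate_itv w lam0 l0 (Zom i I).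
  by rewrite lee_fin -oppr0.
Qed.

(** * The risk bound *)

Unset Implicit Arguments.

Theorem theorem1 (R : realType) :
  exists k : R, 0 <= k /\
  forall (m : nat) (Xs : set (m.-tuple R)) (Ys : set R)
    (f : 'rV[R]_m -> m.-tuple R -> R) (L : R -> R -> R) (Tl : R),
  measurable Xs -> measurable Ys ->
  (forall z : Zsp R m, (Xs `*` Ys) z -> continuous (fun theta => loss f L theta z)) ->
  (forall theta, measurable_fun (Xs `*` Ys) (loss f L theta)) ->
  (forall theta (z : Zsp R m), (Xs `*` Ys) z -> `|loss f L theta z| <= Tl) ->
  forall (P0 : probability (Zsp R m) R),
  P0 (Xs `*` Ys) = 1%E ->
  P0.-integrable (Xs `*` Ys) (fun z : Zsp R m => (L 0 z.2)%:E) ->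
  forall (w : 'rV[R]_m.+1), (forall j, 1 <= w 0 j) ->
  forall (n : nat), (0 < n)%N ->
  forall (dO : measure_display) (Omega : measurableType dO)
    (P : probability Omega R)
    (Zs : 'I_n -> Omega -> Zsp R m) (sg : 'I_n -> Omega -> bool),
  iid_sample_signs P P0 Zs sg ->
  forall (theta : 'rV[R]_m) (rho lam delta : R),
  0 <= rho -> 0 <= lam -> 0 < delta < 1 ->
  ((1 - delta)%:E <=
   P [set om | (dro_risk (Xs `*` Ys) f L w P0 rho theta <=
        (lam * rho)%:E
        + (n%:R^-1)%:E * \sum_(i < n) surrogate (Xs `*` Ys) f L w lam theta (Zs i om)
        + rademacher P Zs sg f L
        + (k * Tl * Num.sqrt (ln delta^-1 / n%:R))%:E)%E])%E.
Proof.
(* The constant is 7 for the deviation plus 1 for the rounding error. *)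
exists 8; split => // m Xs Ys f L Tl mXs mYs _ ml lT P0 P0Z iL w _ n n0 dO Omega
  P Zs sg iid theta rho lam delta _ lam0 d01.
have mZ : measurable (Xs `*` Ys) by exact: measurableX.
have := rademacher_ge0 mZ ml lT P0Z iL iid.
(* The complexity does not depend on [om]; from here on it is a nonnegative extended real
   constant. *)
move: (rademacher P Zs sg f L) => rad rad0.
have [mX _ _] := iid.
have ms := measurable_surrogate (Xs `*` Ys) f L w theta lam0.
set ev := [set om | _].
have mev : measurable ev.
  rewrite -[ev]setTI; apply: emeasurable_fun_c_infty => //.
  apply: emeasurable_funD => //; apply: emeasurable_funD => //.
  apply: emeasurable_funD => //; apply: emeasurable_funM => //.
  by apply: emeasurable_sum => i; exact: (measurableT_comp ms (mX i)).
suff [G [mG PG Gev]] : exists G, [/\ measurable G, ((1 - delta)%:E <= P G)%E &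
    G `<=` ev].
  by apply: le_trans PG _; apply: le_measure => //; rewrite inE.
(* A set of probability one is nonempty, and the loss bound at one of its points forces [Tl] to be
   nonnegative. *)
have Tl0 : 0 <= Tl.
  have [z Zz] : (Xs `*` Ys) !=set0.
    by apply/set0P/eqP => Z0; move/eqP: P0Z; rewrite Z0 measure0 eq_sym onee_eq0.
  exact: le_trans (normr_ge0 _) (lT theta z Zz).
have [Tl0'|TlE] := ltP 0 Tl.
- have [G [a [mG PG droa Ga]]] := dro_risk_concentration w rho mZ (ml theta)
    (lT theta) Tl0' P0Z n0 iid lam0 d01.
  exists G; split => // om /Ga aom; rewrite /ev/=; apply: le_trans droa _.
  rewrite EFinD -!addeA; apply: leeD => //; apply: le_trans aom _.
  by apply: leeD => //; rewrite -[leLHS]add0e; apply: leeD.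
- have Tl_eq0 : Tl = 0 by apply/eqP; rewrite eq_le Tl0 TlE.
  rewrite Tl_eq0 in lT.
  have [G [mG PG dro0 G0]] := dro_risk_concentration0 w rho mZ (ml theta)
    (lT theta) P0Z iid lam0.
  exists G; split => //.
    by rewrite PG lee_fin lerBlDr lerDl; case/andP: d01 => /ltW.
  move=> om /G0 s0; rewrite /ev/= Tl_eq0 mulr0 mul0r adde0.
  apply: le_trans dro0 _; rewrite -[leLHS]adde0 -addeA; apply: leeD => //.
  exact: adde_ge0.
Qed.
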